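(* Let $1\leq k\leq n-2$. Any digraph which achieves the maximum signless Laplacian spectral radius $q$ among all simple strongly connected digraphs on $n$ vertices with vertex connectivity $k$ is isomorphic to $\overrightarrow{K}(n,k,m)$ for some integer $m$ with $1\leq m\leq n-k-1$.
   Context: Digraphs are finite and simple (no loops, no multiple arcs; opposite arcs allowed). $q(D)$ is the spectral radius of the signless Laplacian matrix $Q(D)=\mathrm{diag}(d_1^+,\ldots,d_n^+)+A(D)$, where $d_i^+$ is the outdegree of vertex $i$ and $A(D)$ is the adjacency matrix. The vertex connectivity $\kappa(D)$ is the minimum number of vertices whose removal destroys the strong connectivity of $D$ (with the convention that the complete digraph on $n$ vertices has vertex connectivity $n-1$). $\overrightarrow{K}(n,k,m)$ is the digraph whose vertex set is the disjoint union of sets $S$, $V_1$, $V_2$ with $|S|=k$, $|V_1|=m$, $|V_2|=n-m-k$, and whose arcs are all ordered pairs $(u,v)$ of distinct vertices except those with $u\in V_2$ and $v\in V_1$. *)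

(* Defs.v *)
From HB Require Import structures.
From mathcomp Require Import all_boot all_order all_algebra.
From mathcomp Require Import boolp classical_sets reals.
From mathcomp.real_closed Require Import complex.

Set Implicit Arguments.
Unset Strict Implicit.
Unset Printing Implicit Defensive.

Import Order.TTheory GRing.Theory Num.Theory.

Local Open Scope ring_scope.
Local Open Scope complex_scope.

(* Vertices are 'I_n; an arc relation cannot carry multiple arcs, and opposite
   arcs are independent. *)
Record digraph (n : nat) := Digraph {
  arc :> rel 'I_n;
  arc_irrefl : irreflexive arc
}.

Definition isomorphic (n : nat) (D E : digraph n) : Prop :=
  exists f : 'I_n -> 'I_n, bijective f /\ forall u v, arc D u v = arc E (f u) (f v).

Definition outdegree (n : nat) (D : digraph n) (u : 'I_n) : nat :=
  #|[set v | arc D u v]%SET|.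

Definition adjacency (R : realType) (n : nat) (D : digraph n) : 'M[R[i]]_n :=
  \matrix_(u, v) (arc D u v)%:R.

Definition signless_laplacian (R : realType) (n : nat) (D : digraph n) :
    'M[R[i]]_n :=
  diag_mx (\row_u (outdegree D u)%:R) + adjacency R D.

(* The norm on R[i] takes its (real) values in R[i], whence the real part. For
   n > 0 the supremum is over a nonempty finite set, i.e., it is a maximum. *)
Definition spectral_radius (R : realType) (n : nat) (A : 'M[R[i]]_n) : R :=
  sup [set complex.Re `|z| | z in [set z : R[i] | eigenvalue A z]]%classic.

Definition q (R : realType) (n : nat) (D : digraph n) : R :=
  spectral_radius (signless_laplacian R D).

(* Strong connectivity of the subdigraph induced by W. *)
Definition strong_on (n : nat) (D : digraph n) (W : {set 'I_n}) : bool :=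
  [forall u in W, forall v in W,
     connect [rel x y | [&& x \in W, y \in W & arc D x y]] u v].

Definition strongly_connected (n : nat) (D : digraph n) : bool :=
  strong_on D [set: 'I_n]%SET.

Definition complete (n : nat) (D : digraph n) : bool :=
  [forall u, forall v, (u != v) ==> arc D u v].

(* The default value n is never reached: if (u, v) is not an arc and u != v,
   then removing the n - 2 other vertices destroys strong connectivity. *)
Definition vertex_connectivity (n : nat) (D : digraph n) : nat :=
  if complete D then n.-1
  else \big[minn/n]_(X : {set 'I_n} | ~~ strong_on D (~: X)%SET) #|X|.

(* S = {0, ..., k-1}, V1 = {k, ..., k+m-1}, V2 = {k+m, ..., n-1}; the three
   sets have the intended sizes when k + m <= n. *)
Definition in_V1 (n k m : nat) (u : 'I_n) : bool := (k <= u < k + m)%N.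
Definition in_V2 (n k m : nat) (u : 'I_n) : bool := (k + m <= u)%N.

Definition K_arc (n k m : nat) : rel 'I_n :=
  fun u v => (u != v) && ~~ (in_V2 k m u && in_V1 k m v).

Lemma K_arc_irrefl (n k m : nat) : irreflexive (@K_arc n k m).
Proof. by move=> u; rewrite /K_arc eqxx. Qed.

Definition K (n k m : nat) : digraph n := Digraph (@K_arc_irrefl n k m).

(* Main.v *)
Require Import Defs.
From mathcomp Require Import all_boot all_order all_algebra.
From mathcomp Require Import reals.

(** If [D] has vertex connectivity [k], removing some [k]-set [X] leaves a
    subdigraph that is not strong, so the other vertices split into nonempty
    [A] and [B] with no arc from [B] to [A]. Hence [D] is contained in the
    digraph [E] with all arcs except those from [B] to [A], which is a copy of
    [K(n, k, |A|)] and has the same vertex connectivity. By Perron-Frobenius,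
    adding arcs to a strong digraph strictly increases [q], so [D = E] when
    [D] is extremal. *)

Set Implicit Arguments.
Unset Strict Implicit.
Unset Printing Implicit Defensive.

(** * Vertex connectivity, separations, and the digraphs missing only the arcs from [B] to [A] *)

Section Digraphs.
Variable n : nat.
Implicit Types (D E : digraph n) (X W A B : {set 'I_n}).

Lemma strong_on_sub D E W :
  subrel D E -> strong_on D W -> strong_on E W.
Proof.
move=> DE /forall_inP sD; apply/forall_inP => u uW.
apply/forall_inP => v vW; move/forall_inP: (sD u uW) => /(_ v vW).
apply: connect_sub => x y /and3P[xW yW xy].
by apply: connect1; rewrite /= xW yW DE.
Qed.

Lemma vertex_connectivity_le D X :
  ~~ complete D -> ~~ strong_on D (~: X) -> vertex_connectivity D <= #|X|.
Proof.
rewrite /vertex_connectivity => /negbTE -> sX.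
(* [n] is not neutral for [minn], so the minimum is bounded by induction along the index list. *)
have : X \in index_enum {set 'I_n} by rewrite mem_index_enum.
elim: (index_enum _) => // Y r IHr; rewrite inE => /predU1P[<-|/IHr le_r].
  by rewrite big_cons sX geq_minl.
by rewrite big_cons; case: ifP => // _; rewrite geq_min le_r orbT.
Qed.

(** The strict bound rules out both the complete digraph, of value [n.-1], and the default value
    [n], so the minimum is attained by a separating set. *)
Lemma vertex_connectivity_min D : vertex_connectivity D < n.-1 ->
  exists2 X : {set 'I_n}, #|X| = vertex_connectivity D & ~~ strong_on D (~: X).
Proof.
rewrite /vertex_connectivity; case: ifP => [_|_]; first by rewrite ltnn.
set m := (\big[_/_]_(_ | _) _).
have : m = n \/ exists2 X : {set 'I_n}, #|X| = m & ~~ strong_on D (~: X).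
  rewrite /m; elim/big_ind: _ => [|x y Hx Hy|X sX]; [by left | | by right; exists X].
  by rewrite /minn; case: ifP.
by case=> // ->; rewrite ltnNge leq_pred.
Qed.

(** A set whose removal destroys strong connectivity of [E] also does so in the sparser [D], so the
    minimum for [D] ranges over more sets. *)
Lemma vertex_connectivity_sub D E : subrel D E -> ~~ complete E ->
  vertex_connectivity D <= vertex_connectivity E.
Proof.
move=> DE cE; rewrite [in X in _ <= X]/vertex_connectivity (negbTE cE).
have cD : ~~ complete D.
  apply: contra cE => /forallP cD; apply/forallP => u; apply/forallP => v.
  by apply/implyP => uv; apply: DE; move/forallP: (cD u) => /(_ v)/implyP; exact.
elim/big_ind: _ => [|x y Hx Hy|X sX]; last 1 first.
- apply: vertex_connectivity_le => //.
  by apply: contra sX; apply: strong_on_sub.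
(* Default value [n] of the minimum for [E]: the minimum for [D] never exceeds [n]. *)
- rewrite /vertex_connectivity (negbTE cD); elim/big_ind: _ => // [x y Hx Hy|X _].
    by rewrite geq_min Hx.
  by rewrite -[X in _ <= X]card_ord max_card.
- by rewrite leq_min Hx Hy.
Qed.

(** If [v] is unreachable from [u] inside [W], take for [B] what [u] reaches there and for [A] the
    rest; an arc from [B] to [A] would enlarge [B]. *)
Lemma not_strong_on_split D W : ~~ strong_on D W ->
  exists A B, [/\ A != set0, B != set0, A :|: B = W, [disjoint A & B] &
    forall u v, u \in B -> v \in A -> ~~ D u v].
Proof.
rewrite negb_forall_in => /exists_inP[u uW].
rewrite negb_forall_in => /exists_inP[v vW nuv].
set e := [rel x y | _] in nuv.
pose B := [set x in W | connect e u x].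
exists (W :\: B), B; split.
- by apply/set0Pn; exists v; rewrite !inE vW nuv.
- by apply/set0Pn; exists u; rewrite !inE uW connect0.
- by apply/setP => x; rewrite !inE; case: (x \in W); case: connect.
- by rewrite disjoints_subset; apply/subsetP => x; rewrite !inE => /andP[].
move=> x y; rewrite !inE => /andP[xW ux] /andP[nB yW]; apply: contra nB => xy.
by rewrite yW (connect_trans ux) // connect1 //= xW yW.
Qed.

(** [A] and [B] play the roles of [V1] and [V2], with all other vertices in [S]; arbitrary sets
    postpone the renumbering of vertices. *)
Definition oneway_arc A B : rel 'I_n :=
  fun u v => (u != v) && ~~ ((u \in B) && (v \in A)).

Lemma oneway_arc_irrefl A B : irreflexive (oneway_arc A B).
Proof. by move=> u; rewrite /oneway_arc eqxx. Qed.

Definition oneway A B : digraph n := Digraph (oneway_arc_irrefl A B).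

Lemma sub_oneway D A B :
  (forall u v, u \in B -> v \in A -> ~~ D u v) ->
  subrel D (oneway A B).
Proof.
move=> nD u v uv; apply/andP; split.
  by apply: contraTneq uv => ->; rewrite arc_irrefl.
by apply/negP => /andP[uB vA]; move: (nD u v uB vA); rewrite uv.
Qed.

(** A path inside [A :|: B] that starts in [B] stays in [B], by induction on the path. *)
Lemma oneway_not_strong A B : A != set0 -> B != set0 -> [disjoint A & B] ->
  ~~ strong_on (oneway A B) (A :|: B).
Proof.
move=> /set0Pn[v vA] /set0Pn[u uB] dAB; apply/negP => /forall_inP sAB.
have {sAB} /forall_inP/(_ v) : [forall w in A :|: B,
    connect [rel x y | [&& x \in A :|: B, y \in A :|: B & oneway A B x y]] u w].
  by apply: sAB; rewrite inE uB orbT.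
rewrite inE vA => /(_ isT) /connectP[p].
elim: p u uB => [|w p IHp] u uB /=.
  move=> _ vu; move: vA; rewrite vu => uA.
  by move: dAB; rewrite disjoints_subset => /subsetP/(_ _ uA); rewrite inE uB.
case/andP=> /and3P[_ wAB /andP[_]]; rewrite uB /= => wnA; apply: IHp.
by move: wAB; rewrite inE (negbTE wnA).
Qed.

Lemma oneway_not_complete A B : A != set0 -> B != set0 -> [disjoint A & B] ->
  ~~ complete (oneway A B).
Proof.
move=> /set0Pn[v vA] /set0Pn[u uB] dAB; apply/negP => /forallP/(_ u)/forallP/(_ v).
have -> : u != v.
  apply: contraTneq uB => ->.
  by move: dAB; rewrite disjoints_subset => /subsetP/(_ _ vA); rewrite inE.
by rewrite /= /oneway_arc uB vA andbF.
Qed.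

(** The isomorphism sends a vertex to its position in the list of [S], then [A], then [B], which
    matches the consecutive intervals that define [K]. *)
Lemma oneway_isomorphic A B : [disjoint A & B] ->
  isomorphic (oneway A B) (K n #|~: (A :|: B)| #|A|).
Proof.
move=> dAB; pose S := ~: (A :|: B).
pose s := enum S ++ enum A ++ enum B.
have mems x : x \in s.
  by rewrite !mem_cat !mem_enum !inE; case: (x \in A); case: (x \in B).
have us : uniq s.
  rewrite !cat_uniq !enum_uniq /= andbT; apply/andP; split; apply/hasPn => x.
    by rewrite mem_cat !mem_enum !inE negbK.
  rewrite !mem_enum => xB; apply: contraTN xB => xA.
  by move: dAB; rewrite disjoints_subset => /subsetP/(_ _ xA); rewrite inE.
have sz : size s = n.
  rewrite -[RHS]card_ord -cardsT -(card_uniqP us); apply: eq_card => x.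
  by rewrite mems inE.
have lt x : index x s < n by rewrite -[X in _ < X]sz index_mem.
exists (fun x => Ordinal (lt x)); split.
  apply: injF_bij => x y /(congr1 val) /= eqi.
  by rewrite -[x](nth_index x (mems x)) eqi nth_index.
have idx x : index x s = if x \in S then index x (enum S)
   else #|S| + (if x \in A then index x (enum A) else #|A| + index x (enum B)).
  by rewrite /s !index_cat !mem_enum -!cardE.
have ltS x : x \in S -> index x (enum S) < #|S|.
  by move=> xS; rewrite cardE index_mem mem_enum.
have ltA x : x \in A -> index x (enum A) < #|A|.
  by move=> xS; rewrite cardE index_mem mem_enum.
have inA x : in_V1 #|S| #|A| (Ordinal (lt x)) = (x \in A).
  rewrite /in_V1 /= idx; case: ifP => xS.
    rewrite leqNgt ltS //=; move: xS; rewrite !inE; by case: (x \in A).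
  rewrite leq_addr ltn_add2l; case: ifP => [/ltA //|_].
  by rewrite ltnNge leq_addr.
have inB x : in_V2 #|S| #|A| (Ordinal (lt x)) = (x \in B).
  rewrite /in_V2 /= idx; case: ifP => xS.
    rewrite leqNgt (leq_trans (ltS _ xS)) ?leq_addr //=.
    by move: xS; rewrite !inE; case: (x \in A); case: (x \in B).
  rewrite leq_add2l; case: ifP => [xA|xA].
    rewrite leqNgt ltA //=.
    by move: dAB; rewrite disjoints_subset => /subsetP/(_ _ xA); rewrite inE => /negbTE.
  by rewrite leq_addr; move: xS; rewrite !inE xA; case: (x \in B).
move=> u v; rewrite /= /oneway_arc /K_arc inA inB; congr (~~ _ && _).
apply/eqP/eqP => [-> //|/(congr1 val) /= eqi].
by rewrite -[u](nth_index u (mems u)) eqi nth_index.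
Qed.

End Digraphs.

From mathcomp Require Import boolp classical_sets topology normedtype derive.
From mathcomp.real_closed Require Import complex.
From mathcomp Require Import zify lra.

Import Order.TTheory GRing.Theory Num.Theory.
Import numFieldNormedType.Exports.
Local Open Scope ring_scope.

(** * Perron-Frobenius theory for irreducible nonnegative matrices *)

Section Perron.
Variables (R : realType) (n : nat).
Implicit Types (A B P : 'M[R]_n.+1) (x y : 'rV[R]_n.+1) (r s : R).

Definition nonneg_mx m p (M : 'M[R]_(m, p)) : Prop := forall i j, 0 <= M i j.

(** The exponent may depend on the entry, so this is weaker than primitivity; [k = 0] serves the
    diagonal. *)
Definition irreducible_mx B : Prop := forall i j, exists k, 0 < (B ^+ k) i j.

Lemma nonneg_mulmx m p l (M : 'M[R]_(m, p)) (N : 'M[R]_(p, l)) :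
  nonneg_mx M -> nonneg_mx N -> nonneg_mx (M *m N).
Proof. by move=> M0 N0 i j; rewrite mxE sumr_ge0 // => k _; rewrite mulr_ge0. Qed.

Lemma nonneg_expmx B k : nonneg_mx B -> nonneg_mx (B ^+ k).
Proof.
move=> B0; elim: k => [|k IHk] i j; first by rewrite expr0 mxE ler0n.
by rewrite exprS; apply: nonneg_mulmx.
Qed.

Lemma mulmx_gt0 m p l (M : 'M[R]_(m, p)) (N : 'M[R]_(p, l)) i j k :
  nonneg_mx M -> nonneg_mx N -> 0 < M i k -> 0 < N k j -> 0 < (M *m N) i j.
Proof.
move=> M0 N0 Mik Nkj; rewrite mxE (bigD1 k) //= ltr_wpDr ?mulr_gt0 //.
by apply: sumr_ge0 => h _; rewrite mulr_ge0.
Qed.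

Lemma nonneg_neq0 y : nonneg_mx y -> y != 0 -> exists i, 0 < y 0 i.
Proof.
move=> y0 /rV0Pn[i yi]; exists i.
by rewrite lt_neqAle eq_sym yi y0.
Qed.

(** Since [y *m B ^+ k = r ^+ k *: y], a positive entry [j] of [y] spreads to entry [i] through a
    power of [B] that is positive at [(j, i)]. *)
Lemma eigenvector_gt0 B y r : nonneg_mx B -> irreducible_mx B ->
  nonneg_mx y -> y != 0 -> y *m B = r *: y -> forall i, 0 < y 0 i.
Proof.
move=> B0 iB y0 yn0 yB i; have [j yj] := nonneg_neq0 y0 yn0.
have [k Bji] := iB j i.
have yBk : y *m (B ^+ k) = r ^+ k *: y.
  elim: k {Bji} => [|k IHk]; first by rewrite !expr0 scale1r mulmx1.
  by rewrite exprSr mulmxA IHk -scalemxAl yB scalerA exprSr.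
have : 0 < (y *m (B ^+ k)) 0 i by apply: mulmx_gt0 yj Bji => //; exact: nonneg_expmx.
rewrite yBk mxE lt_neqAle eq_sym mulf_eq0 negb_or => /andP[/andP[_ yi] _].
by rewrite lt_neqAle eq_sym yi y0.
Qed.

(** Choose for each entry a power of [B] that is positive there and add up these powers. *)
Lemma positive_commuting_mx B : nonneg_mx B -> irreducible_mx B ->
  exists2 P : 'M[R]_n.+1, (forall i j, 0 < P i j) & B *m P = P *m B.
Proof.
move=> B0 iB.
have /boolp.choice[k kP] (h : 'I_n.+1 * 'I_n.+1) : exists k, 0 < (B ^+ k) h.1 h.2.
  exact: iB.
exists (\sum_h B ^+ k h) => [i j|].
  rewrite summxE (bigD1 (i, j)) //= ltr_wpDr ?(kP (i, j)) //.
  by apply: sumr_ge0 => h _; exact: nonneg_expmx.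
rewrite mulmx_sumr mulmx_suml; apply: eq_bigr => h _.
by rewrite !mulmxE -exprS -exprSr.
Qed.

Lemma scale_below_pos (I : finType) (a b : I -> R) :
  (forall i, 0 < a i) -> (forall i, 0 < b i) ->
  exists2 e, 0 < e & forall i, e * b i <= a i.
Proof.
move=> a0 b0; have ba i : 0 < b i / a i by rewrite divr_gt0.
have S0 : 0 <= \sum_i b i / a i by apply: sumr_ge0 => i _; exact: ltW.
(* The reciprocal of a number above every ratio [b i / a i]; the added 1 keeps it positive even when
   [I] is empty. *)
exists (1 + \sum_i b i / a i)^-1 => [|i]; first by rewrite invr_gt0 ltr_pwDl.
rewrite mulrC ler_pdivrMr ?ltr_pwDl // mulrC -ler_pdivrMr //.
rewrite (bigD1 i) //= addrCA lerDl addr_ge0 //.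
by apply: sumr_ge0 => h _; exact: ltW.
Qed.

(* Multiplying by a positive matrix commuting with [B] turns a nonzero
   nonnegative defect [y *m B - r *: y] into a positive one. *)
Lemma subinvariant_improve B y r : nonneg_mx B -> irreducible_mx B ->
  nonneg_mx y -> nonneg_mx (y *m B - r *: y) -> y *m B != r *: y ->
  exists s x, [/\ r < s, nonneg_mx x, x != 0 & nonneg_mx (x *m B - s *: x)].
Proof.
move=> B0 iB y0 d0 dn0; have [P P0 BP] := positive_commuting_mx B0 iB.
have Pge0 : nonneg_mx P by move=> i j; exact: ltW.
have yn0 : y != 0.
  by apply: contraNneq dn0 => ->; rewrite mul0mx scaler0.
have [i yi] := nonneg_neq0 y0 yn0.
have [j dj] : exists j, 0 < (y *m B - r *: y) 0 j.
  by apply: nonneg_neq0 => //; rewrite subr_eq0.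
have yP h : 0 < (y *m P) 0 h by apply: mulmx_gt0 yi (P0 i h).
have dP h : 0 < ((y *m B - r *: y) *m P) 0 h by apply: mulmx_gt0 dj (P0 j h).
(* The positive defect dominates [e] times [y *m P], so the bound [r] can be raised by [e]. *)
have [e e0 eP] := scale_below_pos dP yP.
exists (r + e), (y *m P); split.
- by rewrite ltrDl.
- by move=> h l; rewrite ord1 ltW.
- by apply/rV0Pn; exists 0; rewrite gt_eqF.
move=> h l; rewrite ord1; have := eP l.
by rewrite mulmxBl -scalemxAl -!mulmxA BP !mxE; lra.
Qed.

Section Extremal.
Local Open Scope classical_set_scope.

(** The pairs [(r, y)] with [r >= 0], [y] in the unit simplex and [y *m B >= r *: y] form a compact
    set [C], on which the first coordinate attains its maximum. *)
Lemma subinvariance_max B : nonneg_mx B -> exists r y,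
  [/\ nonneg_mx y, y != 0, nonneg_mx (y *m B - r *: y) &
   forall s x, nonneg_mx x -> x != 0 -> nonneg_mx (x *m B - s *: x) -> s <= r].
Proof.
move=> B0; pose M := \sum_j \sum_i B i j.
have M0 : 0 <= M by rewrite !sumr_ge0 // => j _; rewrite sumr_ge0.
pose T := (R * 'rV[R]_n.+1)%type.
pose f j (p : T) : R := (\sum_i p.2 0 i * B i j) - p.1 * p.2 0 j.
pose g (p : T) : R := \sum_i p.2 0 i.
pose K := `[0, M] `*` [set y : 'rV[R]_n.+1 | forall i, `[0, 1]%classic (y 0 i)].
pose C := K `&` (g @^-1` [set a | a = 1] `&`
            \bigcap_(j in [set: 'I_n.+1]) f j @^-1` [set a | 0 <= a]).
have csnd i : continuous (fun p : T => p.2 0 i).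
  move=> p; apply: (@continuous_comp _ _ _ snd (fun y : 'rV[R]_n.+1 => y 0 i)).
    exact: cvg_snd.
  exact: coord_continuous.
have csum (h : 'I_n.+1 -> T -> R) : (forall i, continuous (h i)) ->
    continuous (fun p => \sum_i h i p).
  move=> ch p; apply: (continuous_big (op := +%R)) => //.
  exact: add_continuous.
have cg : continuous g by apply: csum.
have cf j : continuous (f j).
  move=> p; apply: (@continuousB R R^o _ (fun p : T => \sum_i p.2 0 i * B i j)
    (fun p : T => p.1 * p.2 0 j)).
    apply: csum => i q.
    apply: (@continuousM _ _ (fun p : T => p.2 0 i) (fun=> B i j)).
      exact: csnd.
    exact: cst_continuous.
  apply: (@continuousM _ _ fst (fun p : T => p.2 0 j)); [exact: cvg_fst|exact: csnd].
have cK : compact K.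
  apply: compact_setX; first exact: segment_compact.
  exact: (@rV_compact R n.+1 (fun=> `[0, 1]%classic) (fun=> @segment_compact R 0 1)).
have cC : compact C.
  apply: compact_closedI => //.
  apply: closedI.
    by apply: preimage_closed; [move=> p _; exact: cg | exact: closed_eq].
  apply: closed_bigI => j _.
  by apply: preimage_closed; [move=> p _; exact: cf | exact: closed_ge].
(* Dividing [x] by the sum of its entries puts any pair with [s >= 0] into [C]. *)
have inC s x : 0 <= s -> nonneg_mx x -> x != 0 -> nonneg_mx (x *m B - s *: x) ->
    exists2 y, C (s, y) & y = (\sum_i x 0 i)^-1 *: x.
  move=> s0 x0 xn0 xB; have [i xi] := nonneg_neq0 x0 xn0.
  have S0 : 0 < \sum_i x 0 i.
    by rewrite (bigD1 i) //= ltr_wpDr // sumr_ge0.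
  set S := \sum_i _ in S0 *; set y := S^-1 *: x.
  have y0 j : 0 <= y 0 j by rewrite mxE mulr_ge0 // invr_ge0 ltW.
  have gy : \sum_j y 0 j = 1.
    under eq_bigr do rewrite mxE.
    by rewrite -mulr_sumr mulVf // gt_eqF.
  have y1 j : y 0 j <= 1.
    by rewrite -gy (bigD1 j) //= lerDl sumr_ge0.
  have fy j : s * y 0 j <= \sum_i y 0 i * B i j.
    have := xB 0 j; rewrite !mxE subr_ge0 => H.
    under eq_bigr do rewrite mxE -mulrA.
    by rewrite -mulr_sumr mulrCA ler_pM2l ?invr_gt0.
  exists y => //; split; last first.
    by split=> //= j _; rewrite /f /= subr_ge0.
  split=> /=; last by move=> j; rewrite /= in_itv /= y0 y1.
  (* Summing [fy] over [j] gives [s <= M], because the entries of [y] sum to 1 and are at most 1. *)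
  rewrite in_itv /= s0 /= -[s]mulr1 -gy mulr_sumr; apply: ler_sum => j _.
  apply: (le_trans (fy j)); apply: ler_sum => h _.
  by rewrite ler_piMl.
have C0 : C !=set0.
  have [|||j|y Cy _] := inC 0 (const_mx 1); last by exists (0, y).
  - by [].
  - by move=> i j; rewrite mxE.
  - by apply/rV0Pn; exists 0; rewrite mxE oner_eq0.
  - move=> l; rewrite scale0r subr0; apply: nonneg_mulmx => // h k.
    by rewrite mxE.
have [|[r y] /set_mem[[/= r0M y01] [/= gy /= fy]] rmax] :=
    compact_EVT_max (f := fst) C0 cC.
  by apply: continuous_subspaceT => p; exact: cvg_fst.
have {}rmax s x : nonneg_mx x -> x != 0 -> nonneg_mx (x *m B - s *: x) -> s <= r.
  (* Negative [s] falls outside [C], but is below [r] because [r >= 0]. *)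
  move=> x0 xn0 xB; have [s0|/ltW s0] := leP 0 s; last first.
    by apply: le_trans s0 _; move: r0M; rewrite in_itv /= => /andP[].
  by have [z Cz _] := inC s x s0 x0 xn0 xB; apply: (rmax (s, z)); apply/mem_set.
exists r, y; split=> //.
- by move=> i j; rewrite ord1; have := y01 j; rewrite /= in_itv /= => /andP[].
- apply/eqP => y0; move: gy; rewrite /g /= y0.
  under eq_bigr do rewrite mxE.
  by rewrite big1 // => /esym/eqP; rewrite oner_eq0.
- by move=> i j; rewrite ord1; have := fy j Logic.I; rewrite /f /= !mxE.
Qed.
End Extremal.

(* The last clause (Collatz-Wielandt) will identify [r] as the spectral radius. *)
Lemma perron_frobenius B : nonneg_mx B -> irreducible_mx B -> exists r y,
  [/\ forall i, 0 < y 0 i, y *m B = r *: y &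
   forall s x, nonneg_mx x -> x != 0 -> nonneg_mx (x *m B - s *: x) -> s <= r].
Proof.
move=> B0 iB; have [r [y [y0 yn0 yB rmax]]] := subinvariance_max B0.
have yBr : y *m B = r *: y.
  (* A nonzero defect could be improved to some [s > r], against the maximality of [r]. *)
  apply/eqP/negPn/negP => /(subinvariant_improve B0 iB y0 yB)[s [x [rs x0 xn0 xB]]].
  by have := rmax s x x0 xn0 xB; rewrite leNgt rs.
by exists r, y; split=> //; exact: eigenvector_gt0 yBr.
Qed.

(** Take the moduli of the entries of an eigenvector and apply the triangle inequality to each
    coordinate of [v *m B]. *)
Lemma eigenvalue_subinvariant B (z : R[i]) : nonneg_mx B ->
  eigenvalue (map_mx (real_complex R) B) z ->
  exists x, [/\ nonneg_mx x, x != 0 & nonneg_mx (x *m B - complex.Re `|z| *: x)].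
Proof.
move=> B0 /eigenvalueP[v vB vn0]; pose x : 'rV[R]_n.+1 := \row_i complex.Re `|v 0 i|.
have normE (w : R[i]) : `|w| = (complex.Re `|w|)%:C%C by rewrite normc_def.
exists x; split.
- by move=> i j; rewrite mxE -lecR -normE normr_ge0.
- have /rV0Pn[i vi] := vn0; apply/rV0Pn; exists i; rewrite mxE.
  by apply: contra vi => /eqP xi; rewrite -normr_eq0 normE xi.
move=> i j; rewrite ord1 !mxE subr_ge0 -lecR rmorphM /= -!normE -normrM.
have := congr1 (fun w : 'rV[R[i]]_n.+1 => w 0 j) vB; rewrite !mxE => <-.
rewrite rmorph_sum /=; apply: le_trans (ler_norm_sum _ _ _) _.
apply: ler_sum => h _; rewrite !mxE rmorphM /= -normE normrM ler_wpM2l // ger0_norm //.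
by rewrite lecR.
Qed.

Lemma spectral_radius_perron B r y : nonneg_mx B ->
  nonneg_mx y -> y != 0 -> y *m B = r *: y ->
  (forall s x, nonneg_mx x -> x != 0 -> nonneg_mx (x *m B - s *: x) -> s <= r) ->
  spectral_radius (map_mx (real_complex R) B) = r.
Proof.
move=> B0 y0 yn0 yB rmax.
(* Testing maximality with [s = 0] gives [r >= 0], so that [r] is its own modulus. *)
have r0 : 0 <= r.
  by apply: (rmax 0 y) => //; rewrite scale0r subr0; exact: nonneg_mulmx.
rewrite /spectral_radius; set E := [set _ | _ in _]%classic.
have Er : E r.
  exists (r%:C)%C; last by rewrite ger0_norm ?lecR.
  rewrite /= eigenvalue_map; apply/eigenvalueP; by exists y.
have ubE : ubound E r.
  move=> _ [z /= zB <-].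
  by have [x [x0 xn0 xB]] := eigenvalue_subinvariant B0 zB; exact: rmax xB.
apply/eqP; rewrite eq_le ge_sup //=; last by exists r.
by apply: ub_le_sup => //; exists r.
Qed.

(** The Perron vector [y] of [A] satisfies [y *m B >= r *: y] with a nonzero defect, so [B] admits a
    subinvariant vector for some [t > r]. *)
Lemma spectral_radius_lt A B : nonneg_mx A -> irreducible_mx A ->
  nonneg_mx B -> irreducible_mx B -> nonneg_mx (B - A) -> A != B ->
  spectral_radius (map_mx (real_complex R) A) <
  spectral_radius (map_mx (real_complex R) B).
Proof.
move=> A0 iA B0 iB AB nAB.
have [r [y [y_gt0 yA rmax]]] := perron_frobenius A0 iA.
have [s [x [x_gt0 xB smax]]] := perron_frobenius B0 iB.
have nn (v : 'rV[R]_n.+1) : (forall i, 0 < v 0 i) -> nonneg_mx v.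
  by move=> v0 i j; rewrite ord1 ltW.
have nz (v : 'rV[R]_n.+1) : (forall i, 0 < v 0 i) -> v != 0.
  by move=> v0; apply/rV0Pn; exists 0; rewrite gt_eqF.
rewrite (spectral_radius_perron A0 (nn _ y_gt0) (nz _ y_gt0) yA rmax).
rewrite (spectral_radius_perron B0 (nn _ x_gt0) (nz _ x_gt0) xB smax).
have yBA : y *m B - r *: y = y *m (B - A) by rewrite mulmxBr yA.
have yB : nonneg_mx (y *m B - r *: y).
  by rewrite yBA; apply: nonneg_mulmx => //; exact: nn.
(* All entries of [y] are positive, so a single positive entry of [B - A] already shows up in
   [y *m (B - A)]. *)
have yBn : y *m B != r *: y.
  rewrite -subr_eq0 yBA; apply: contra nAB => /eqP yBA0.
  rewrite eq_sym -subr_eq0; apply/eqP/matrixP => i j; rewrite [RHS]mxE.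
  apply/eqP/negPn/negP => ABij.
  have : 0 < (y *m (B - A)) 0 j.
    by apply: (mulmx_gt0 (nn _ y_gt0) AB (y_gt0 i)); rewrite lt_neqAle eq_sym ABij AB.
  by rewrite yBA0 mxE ltxx.
have [t [v [rt v0 vn0 vB]]] := subinvariant_improve B0 iB (nn _ y_gt0) yB yBn.
exact: lt_le_trans rt (smax _ _ v0 vn0 vB).
Qed.

End Perron.

(** * Strict monotonicity of [q] under adding arcs *)

Section SignlessLaplacian.
Variables (R : realType) (n : nat).
Implicit Types D E : digraph n.+1.

(** A real copy of the matrix, since the order arguments above take place over [R]. *)
Definition real_signless_laplacian D : 'M[R]_n.+1 :=
  \matrix_(u, v) ((outdegree D u)%:R *+ (u == v) + (D u v)%:R).

Lemma signless_laplacianE D :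
  signless_laplacian R D = map_mx (real_complex R) (real_signless_laplacian D).
Proof.
apply/matrixP => u v; rewrite !mxE rmorphD /= rmorphMn /= !rmorph_nat.
by case: eqP => [->|].
Qed.

Lemma real_signless_laplacian_ge0 D : nonneg_mx (real_signless_laplacian D).
Proof. by move=> u v; rewrite mxE addr_ge0 ?mulrn_wge0 ?ler0n. Qed.

(** A path from [u] to [v] of length [k] makes the [(u, v)] entry of the [k]-th power positive. *)
Lemma real_signless_laplacian_irr D :
  strongly_connected D -> irreducible_mx (real_signless_laplacian D).
Proof.
move=> /forall_inP sD u v; move/forall_inP: (sD u (finset.in_setT u)) => /(_ v (finset.in_setT v)).
case/connectP => p; elim: p u => [|w p IHp] u /=.
  by move=> _ ->; exists 0%N; rewrite expr0 mxE eqxx ltr01.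
case/andP=> /and3P[_ _ uw] /IHp /[apply] -[k wv].
exists k.+1; rewrite exprS; apply: mulmx_gt0 wv.
- exact: real_signless_laplacian_ge0.
- exact: nonneg_expmx (real_signless_laplacian_ge0 D).
- by rewrite mxE uw ltr_wpDl ?mulrn_wge0 ?ler0n ?ltr01.
Qed.

Lemma outdegree_sub D E u : subrel D E -> (outdegree D u <= outdegree E u)%N.
Proof.
by move=> DE; apply/subset_leq_card/fintype.subsetP => v; rewrite !inE; exact: DE.
Qed.

Lemma q_lt D E : strongly_connected D -> subrel D E ->
  (exists u v, E u v && ~~ D u v) -> q R D < q R E.
Proof.
move=> sD DE [u [v /andP[Euv Duv]]].
have sE : strongly_connected E by exact: strong_on_sub sD.
have arcs x y : (D x y)%:R <= (E x y)%:R :> R.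
  by rewrite ler_nat; case: (D x y) (@DE x y) => // ->.
rewrite /q !signless_laplacianE; apply: spectral_radius_lt.
- exact: real_signless_laplacian_ge0.
- exact: real_signless_laplacian_irr.
- exact: real_signless_laplacian_ge0.
- exact: real_signless_laplacian_irr.
- move=> x y; rewrite !mxE subr_ge0 lerD //.
  by rewrite lerMn2r ler_nat outdegree_sub ?orbT.
(* The matrices differ at the new arc, an off-diagonal entry untouched by outdegrees. *)
apply/eqP => /matrixP/(_ u v); rewrite !mxE Euv (negbTE Duv).
have /negbTE -> : u != v by apply: contraTneq Euv => ->; rewrite arc_irrefl.
by move/eqP; rewrite !mulr0n !add0r eq_sym oner_eq0.
Qed.

End SignlessLaplacian.

Theorem mainTheorem6 (R : realType) (n k : nat) (hk : (1 <= k <= n - 2)%N)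
    (D : digraph n)
    (D_strong : strongly_connected D)
    (D_conn : vertex_connectivity D = k)
    (D_max : forall E : digraph n,
       strongly_connected E -> vertex_connectivity E = k -> q R E <= q R D) :
  exists m : nat, (1 <= m <= n - k - 1)%N /\ isomorphic D (K n k m).
Proof.
case: n hk D D_strong D_conn D_max => [|n] hk D D_strong D_conn D_max.
  (* For [n = 0] the truncated [n - 2] is 0, which contradicts [1 <= k]. *)
  by case: k hk {D_conn D_max} => //.
have [X cX sX] : exists2 X : {set 'I_n.+1}, #|X| = k & ~~ strong_on D (~: X).
  by rewrite -D_conn; apply: vertex_connectivity_min; rewrite D_conn /=; lia.
have [A [B [A0 B0 AB dAB nBA]]] := not_strong_on_split sX.
have DE := sub_oneway nBA.
have cE := oneway_not_complete A0 B0 dAB.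
have E_conn : vertex_connectivity (oneway A B) = k.
  (* Removing [X] still separates [oneway A B], giving at most [k]; containing [D] gives at least
     [k]. *)
  apply/eqP; rewrite eqn_leq -{1}cX -D_conn vertex_connectivity_sub // andbT.
  by apply: vertex_connectivity_le; rewrite // -AB oneway_not_strong.
have E_strong : strongly_connected (oneway A B) := strong_on_sub DE D_strong.
have DeqE u v : D u v = oneway A B u v.
  apply/idP/idP => [/DE //|Euv]; apply: contraT => Duv.
  have := D_max _ E_strong E_conn; rewrite leNgt => /negP[].
  by apply: q_lt => //; exists u, v; rewrite Euv.
exists #|A|; split.
  (* [A], [B] and [X] partition the vertices, and [B] is nonempty, whence the upper bound on the
     size of [A]. *)
  have := cardsC X; rewrite -AB cardsU disjoint_setI0 // cards0 card_ord cX.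
  by rewrite -!card_gt0 in A0 B0 *; lia.
have [f [bf fP]] := oneway_isomorphic dAB.
exists f; split=> // u v; rewrite DeqE fP.
by rewrite AB finset.setCK cX.
Qed.
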